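(* Fix a state $s$, a proposal $a\in\mathbb R^A$, and real numbers $\tau>0$, $\delta>0$, and let $Q(s,\cdot):\mathbb R^A\to\mathbb R$ be differentiable. Let $d(t)=t^2+(1-t)^2$, let $v_0(y,t)=\frac{2t-1}{d(t)}\,y$ be the velocity field of the Gaussian reference flow, and let $\sigma_t=\sqrt{2(1-t)/t}$ for $0<t<1$. Let $y_1\in\mathbb R^A$ be an endpoint, put $\tilde a_1=a+\delta y_1$, and for $t\in(0,1)$ let $y_t=t y_1+(1-t)\varepsilon$ with $\varepsilon\sim\mathcal N(0,I)$ be a bridge sample. Then the adjoint matching velocity target for the Gaussian reference with velocity $v_0$ and terminal cost $y\mapsto-\tau Q(s,a+\delta y)$ is $$v^{\mathrm{tgt}}(y_t,y_1,t\mid s,a)=\frac{2t-1}{d(t)}\,y_t+\frac{\tau\delta(1-t)}{d(t)}\,\nabla_{\tilde a}Q(s,\tilde a_1).$$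
   Context: The reference process associated with the velocity field $v_0$ is the memoryless SDE on $\mathbb R^A$ $$\mathrm dY_t=b(Y_t,t)\,\mathrm dt+\sigma_t\,\mathrm dB_t,\qquad b(y,t)=2v_0(y,t)-\frac{y}{t},\qquad 0<t<1,$$ with $B$ a standard Brownian motion. Lean adjoint: for a trajectory $\mathbf Y=(Y_t)$ with endpoint $Y_1=y_1$, the lean adjoint $\lambda(t)=\lambda(\mathbf Y,t)\in\mathbb R^A$, $t\in(0,1]$, is the solution of the backward linear ODE $$\frac{\mathrm d\lambda(t)}{\mathrm dt}=-\big[\nabla_y b(Y_t,t)\big]\lambda(t),\qquad \lambda(1)=-\tau\,\nabla_y Q(s,a+\delta y)\big|_{y=y_1}.$$ Adjoint matching velocity target: for a trajectory with $Y_1=y_1$ and $Y_t=y_t$, the adjoint matching velocity target is by definition $$v^{\mathrm{tgt}}(y_t,y_1,t\mid s,a)=v_0(y_t,t)-\frac{\sigma_t^2}{2}\,\lambda(t).$$ $\nabla_{\tilde a}Q(s,\tilde a_1)$ denotes the gradient of $\tilde a\mapsto Q(s,\tilde a)$ evaluated at $\tilde a_1$. *)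

(* Defs.v *)
From HB Require Import structures.
From mathcomp Require Import all_boot all_order all_algebra.
From mathcomp Require Import all_classical all_reals all_analysis.
Set Implicit Arguments.
Unset Strict Implicit.
Unset Printing Implicit Defensive.
Import Order.TTheory GRing.Theory Num.Theory.
Import numFieldNormedType.Exports.
Local Open Scope classical_set_scope.
Local Open Scope ring_scope.

(* Vectors of R^A are row vectors.  A time-dependent vector field takes the
   position first and the time second, as in v_0(y, t). *)

Definition gradient (R : realType) (A : nat) (f : 'rV[R]_A -> R)
    (x : 'rV[R]_A) : 'rV[R]_A :=
  \row_i 'D_(delta_mx 0 i) f x.

(* N(0, I): measurable coordinates whose joint law on measurable boxes is the
   product of standard normal laws. *)
Definition standard_gaussian (R : realType) (d : measure_display)
    (Omega : measurableType d) (P : probability Omega R) (A : nat)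
    (eps : Omega -> 'rV[R]_A) : Prop :=
  (forall i : 'I_A, measurable_fun setT (fun w => eps w 0 i)) /\
  (forall B : 'I_A -> set R, (forall i, measurable (B i)) ->
     P [set w | forall i, B i (eps w 0 i)] =
     (\prod_(i < A) normal_prob (0 : R) 1 (B i))%E).

Definition noise_schedule (R : realType) (t : R) : R :=
  Num.sqrt (2 * (1 - t) / t).

Definition reference_drift (R : realType) (A : nat)
    (v0 : 'rV[R]_A -> R -> 'rV[R]_A) (y : 'rV[R]_A) (t : R) : 'rV[R]_A :=
  2 *: v0 y t - t^-1 *: y.

(* [lam] solves the backward linear ODE on (0, 1], with terminal value at 1
   attained continuously (the drift is only given for 0 < t < 1).
   MathComp's 'J f has entries d f_j / d y_i at (i, j), which is the matrix
   [nabla f] acting on column vectors; for row vectors it acts on the right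
   by its transpose. *)
Definition is_lean_adjoint (R : realType) (A : nat)
    (v0 : 'rV[R]_A -> R -> 'rV[R]_A) (Qs : 'rV[R]_A -> R) (a : 'rV[R]_A)
    (tau delta : R) (Y lam : R -> 'rV[R]_A) : Prop :=
  [/\ lam 1 = - tau *: gradient (fun y => Qs (a + delta *: y)) (Y 1),
      lam t @[t --> 1^'-] --> lam 1
    & forall t : R, 0 < t < 1 ->
        is_derive t (1 : R) lam
          (- (lam t *m ('J (fun y => reference_drift v0 y t) (Y t))^T))].

(* The zero function when the ODE has no solution; only the values on (0, 1]
   are meaningful. *)
Definition lean_adjoint (R : realType) (A : nat)
    (v0 : 'rV[R]_A -> R -> 'rV[R]_A) (Qs : 'rV[R]_A -> R) (a : 'rV[R]_A)
    (tau delta : R) (Y : R -> 'rV[R]_A) : R -> 'rV[R]_A :=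
  xget (cst 0) [set lam | is_lean_adjoint v0 Qs a tau delta Y lam].

(* The target along the trajectory Y, i.e. v^tgt(Y t, Y 1, t | s, a) with
   Qs = Q(s, .). *)
Definition adjoint_matching_target (R : realType) (A : nat)
    (v0 : 'rV[R]_A -> R -> 'rV[R]_A) (sigma : R -> R) (Qs : 'rV[R]_A -> R)
    (a : 'rV[R]_A) (tau delta : R) (Y : R -> 'rV[R]_A) (t : R) : 'rV[R]_A :=
  v0 (Y t) t - (sigma t ^+ 2 / 2) *: lean_adjoint v0 Qs a tau delta Y t.

Definition gaussian_denom (R : realType) (t : R) : R := t ^+ 2 + (1 - t) ^+ 2.

Definition gaussian_velocity (R : realType) (A : nat) (y : 'rV[R]_A) (t : R) :
    'rV[R]_A :=
  ((2 * t - 1) / gaussian_denom t) *: y.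

(* Main.v *)
(** The drift is linear, [b(y, x) = c(x) y] with [c = d'/d - 1/x], so the lean
    adjoint equation is [lam' = - c lam] whatever the trajectory is. Its
    integrating factor gives [lam(x) = (x / d(x)) lam(1)], and
    [sigma_x ^ 2 / 2 = (1 - x) / x] cancels the factor [x]. *)

Require Import Defs.
From HB Require Import structures.
From mathcomp Require Import all_boot all_order all_algebra.
From mathcomp Require Import all_classical all_reals all_analysis.
From mathcomp Require Import ring lra.
Import Order.TTheory GRing.Theory Num.Theory.
Import numFieldNormedType.Exports.
Local Open Scope classical_set_scope.
Local Open Scope ring_scope.

(** Chain rule: the inner map has differential [*:%R delta], and linearity of ['d f] pulls [delta]
    out. This is the source of the factor [delta] in the target. *)
Lemma gradient_affine (R : realType) (A : nat) (f : 'rV[R]_A -> R)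
    (a y : 'rV[R]_A) (delta : R) :
  differentiable f (a + delta *: y) ->
  gradient (fun z => f (a + delta *: z)) y =
  delta *: gradient f (a + delta *: y).
Proof.
move=> df; apply/rowP => i; rewrite !mxE.
pose g z : 'rV[R]_A := a + delta *: z.
have dg : is_diff y g ( *:%R delta).
  have h : is_diff y (cst a + *:%R delta) (0 + *:%R delta) by exact: is_diffD.
  by rewrite add0r in h.
have dfg : is_diff y (f \o g) ('d f (g y) \o *:%R delta).
  have dfg' : is_diff (g y) f ('d f (g y)) by exact/differentiableP.
  exact: is_diff_comp.
by rewrite -[LHS]/('D_ _ (f \o g) y) !deriveE// diff_val /= linearZ.
Qed.

Lemma jacobian_scale (R : realType) (A : nat) (c : R) (x : 'rV[R]_A) :
  'J (fun y : 'rV[R]_A => c *: y) x = c%:M.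
Proof.
apply/row_matrixP => i; rewrite !rowE mul_rV_lin1 diff_val.
by rewrite mul_mx_scalar.
Qed.

(** Reduces the vector ODE to scalar equations, to which the product rule and the mean value theorem
    apply. *)
Lemma is_derive_rowP (R : realType) (A : nat) (f : R -> 'rV[R]_A) (t : R)
    (df : 'rV[R]_A) :
  is_derive t (1 : R) f df <->
  forall i, is_derive t (1 : R) (fun x => f x 0 i) (df 0 i).
Proof.
split=> [h i|h].
  have dfP : derivable f t 1 by [].
  split; first by move/derivable_mxP : dfP; exact.
  by have := derive_mx dfP; rewrite derive_val => ->; rewrite mxE.
have dfP : derivable f t 1.
  by apply/derivable_mxP => i j; rewrite (ord1 i); have [] := h j.
split=> //; rewrite derive_mx//; apply/rowP => i; rewrite !mxE.
by have [] := h i.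
Qed.

(** Mean value theorem on [[t, b]]. A left limit at [b] suffices there, which matches the way the
    lean adjoint attains its terminal value. *)
Lemma derive0_left_cst (R : realType) (F : R -> R) (a b t : R) :
  a < t < b -> (forall x, a < x < b -> is_derive x (1 : R) F 0) ->
  F x @[x --> b^'-] --> F b -> F t = F b.
Proof.
move=> /andP[at_ tb] dF Fb.
have cF x : a < x < b -> {for x, continuous F}.
  move=> /dF h; apply/differentiable_continuous/derivable1_diffP.
  by case: h.
have [| |c _] := @MVT R F (cst 0) t b tb.
- move=> x; rewrite in_itv/= => /andP[tx xb]; apply: dF.
  by rewrite (lt_trans at_ tx).
- apply/(continuous_within_itvP _ tb); split => //.
    move=> x; rewrite in_itv/= => /andP[tx xb]; apply: cF.
    by rewrite (lt_trans at_ tx).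
  by apply: cvg_at_right_filter; apply: cF; rewrite at_.
by rewrite mul0r => /eqP; rewrite subr_eq0 => /eqP.
Qed.

Lemma gaussian_denom_gt0 (R : realType) (t : R) : 0 < gaussian_denom t.
Proof. by rewrite /gaussian_denom; nra. Qed.

Lemma is_derive_gaussian_denom (R : realType) (t : R) :
  is_derive t (1 : R) (@gaussian_denom R) (2 * (2 * t - 1)).
Proof.
(* Written with operations on functions, a convertible form on which the differentiation rules are
   inferred. *)
have h : is_derive t (1 : R) ((id : R -> R) ^+ 2 + (cst 1 - id) ^+ 2)
   (2 * (2 * t - 1)).
  by apply: is_derive_eq; rewrite /GRing.scale /= !fctE; ring.
exact: h.
Qed.

(** [lean_adjoint] is a chosen solution, so both halves are needed: an explicit solution shows that
    the choice is not the default, and uniqueness identifies the chosen one. *)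
Lemma lean_adjoint_gaussianE (R : realType) (A : nat) (Qs : 'rV[R]_A -> R)
    (a : 'rV[R]_A) (tau delta : R) (Y : R -> 'rV[R]_A) (t : R) :
  0 < t < 1 ->
  lean_adjoint (@gaussian_velocity R A) Qs a tau delta Y t =
  (t / gaussian_denom t) *:
    (- tau *: gradient (fun y => Qs (a + delta *: y)) (Y 1)).
Proof.
set l1 := - tau *: _ => t01.
pose c (x : R) : R := 2 * ((2 * x - 1) / gaussian_denom x) - x^-1.
pose r (x : R) : R := x / gaussian_denom x.
have dneq0 (x : R) : gaussian_denom x != 0 by rewrite gt_eqF// gaussian_denom_gt0.
have denom1 : gaussian_denom 1 = 1 :> R by rewrite /gaussian_denom; ring.
have driftE x :
    'J (fun y : 'rV[R]_A => reference_drift (@gaussian_velocity R A) y x) (Y x) =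
    (c x)%:M.
  rewrite -(jacobian_scale _ _ _ (Y x)); congr jacobian; apply/funext => y.
  by rewrite /reference_drift /gaussian_velocity scalerA -scalerBl.
have odeE (v : 'rV[R]_A) x :
    - (v *m ('J (fun y : 'rV[R]_A =>
        reference_drift (@gaussian_velocity R A) y x) (Y x))^T) = - (c x *: v).
  by rewrite driftE tr_scalar_mx mul_mx_scalar.
(* Since [gaussian_denom] never vanishes, this covers [x = 1], where it gives the continuity needed
   for the terminal limits. *)
have dr (x : R) : x != 0 -> is_derive x (1 : R) r (- (c x * r x)).
  move=> x0; have h1 := is_derive_gaussian_denom R x.
  have h2 := is_deriveV (dneq0 x) h1.
  have h : is_derive x (1 : R)
      ((id : R -> R) * (fun y => (gaussian_denom y)^-1)) (- (c x * r x)).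
    apply: is_derive_eq; rewrite /GRing.scale /= /c /r; field.
    by rewrite dneq0.
  exact: h.
have solE : is_lean_adjoint (@gaussian_velocity R A) Qs a tau delta Y
    (fun x => r x *: l1).
  split.
  - by rewrite /r denom1 divr1 scale1r.
  - apply: cvg_at_left_filter; apply: cvgZr_tmp.
    apply/differentiable_continuous/derivable1_diffP.
    by have [] := dr 1 (oner_neq0 R).
  - move=> x /andP[x0 x1]; rewrite odeE; apply/is_derive_rowP => i.
    have rx := dr x (lt0r_neq0 x0).
    have h : is_derive x (1 : R) (l1 0 i \*: r) ((- (c x *: (r x *: l1))) 0 i).
      apply: is_derive_eq; rewrite !mxE /GRing.scale /=; ring.
    suff -> : (fun y => (r y *: l1) 0 i) = l1 0 i \*: r by [].
    by apply/funext => y; rewrite !mxE mulrC.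
(* Existence is settled; from here on only the defining properties of the chosen solution are
   used. *)
rewrite /lean_adjoint; have [lam1 lam_cvg lam_ode] := xgetI (cst 0) solE.
set lam := xget _ _ in lam1 lam_cvg lam_ode *.
apply/rowP => i; rewrite mxE.
(* Uniqueness: in the quotient of a solution by [r] the terms in [c] cancel, so [F] is constant, and
   [r 1 = 1] makes its value the terminal one. *)
pose F (x : R) : R := (r x)^-1 * lam x 0 i.
have rneq0 (x : R) : 0 < x -> r x != 0.
  by move=> x0; rewrite mulf_neq0 ?invr_eq0 ?dneq0 ?gt_eqF.
have dV (x : R) : 0 < x -> is_derive x (1 : R) (fun y => (r y)^-1) (c x / r x).
  move=> x0; have rx := dr x (lt0r_neq0 x0).
  apply: is_derive_eq (is_deriveV (rneq0 _ x0) rx) _.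
  by rewrite /GRing.scale /=; field; rewrite rneq0.
have : F t = F 1.
  apply: (derive0_left_cst _ _ _ _ _ t01).
    move=> x /andP[x0 x1].
    have := lam_ode x; rewrite odeE x0 x1 => /(_ isT)/is_derive_rowP/(_ i) dl.
    have dVx := dV x x0.
    have h : is_derive x (1 : R)
        ((fun y => (r y)^-1) * (fun y => lam y 0 i)) 0.
      apply: is_derive_eq; rewrite !mxE /GRing.scale /=; ring.
    exact: h.
  (* At 1 only a left limit of [lam] is known, while the inverse of [r] is continuous there. *)
  apply: cvgM.
    have cV : {for 1, continuous (fun y => (r y)^-1)}.
      apply/differentiable_continuous/derivable1_diffP.
      by have [] := dV 1 ltr01.
    exact: cvg_at_left_filter cV.
  apply: (cvg_comp lam (fun v : 'rV[R]_A => v 0 i) lam_cvg).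
  exact: coord_continuous.
have /andP[t0 t1] := t01.
rewrite /F {2}/r denom1 divr1 invr1 mul1r lam1 => <-.
by rewrite -[t / _]/(r t) mulVKf ?rneq0.
Qed.

Theorem proposition3p2 (R : realType) (A : nat) (S : Type)
    (Q : S -> 'rV[R]_A -> R) (s : S) (a : 'rV[R]_A) (tau delta : R)
    (tau_gt0 : 0 < tau) (delta_gt0 : 0 < delta)
    (Q_diff : forall x : 'rV[R]_A, differentiable (Q s) x)
    (d : measure_display) (Omega : measurableType d)
    (P : probability Omega R) (eps : Omega -> 'rV[R]_A)
    (eps_gauss : standard_gaussian P eps)
    (y1 : 'rV[R]_A) (t : R) (t_in01 : 0 < t < 1)
    (w : Omega) (Y : R -> 'rV[R]_A) (Y_end : Y 1 = y1)
    (Y_bridge : Y t = t *: y1 + (1 - t) *: eps w) :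
  adjoint_matching_target (@gaussian_velocity R A) (@noise_schedule R)
    (Q s) a tau delta Y t =
  ((2 * t - 1) / gaussian_denom t) *: (t *: y1 + (1 - t) *: eps w) +
  (tau * delta * (1 - t) / gaussian_denom t) *:
    gradient (Q s) (a + delta *: y1).
Proof.
have /andP[t0 t1] := t_in01.
rewrite /adjoint_matching_target lean_adjoint_gaussianE// Y_end gradient_affine//.
(* The minus sign of the target cancels that of the terminal condition; a scalar identity
   remains. *)
rewrite /gaussian_velocity Y_bridge -scaleNr !scalerA; congr (_ + _ *: _).
(* Squaring undoes the root only for a nonnegative radicand, hence the use of [0 < t < 1]. *)
rewrite /noise_schedule sqr_sqrtr; last first.
  by rewrite divr_ge0 ?mulr_ge0 ?subr_ge0 1?ltW.
by field; rewrite !gt_eqF ?gaussian_denom_gt0.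
Qed.
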